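(* Let $\mathcal{T} \subseteq \mathcal{F}$ be a chain of sets. Then the following statements are logically equivalent. 1. $\mathcal{T}_* \subseteq \mathcal{F}$ and for any $\mathcal{C} \subseteq \mathcal{T}$, $\nu(\bigcup \mathcal{C}) = \sup_{C \in \mathcal{C}} \nu(C)$ and $\nu(\bigcap \mathcal{C}) = \inf_{C \in \mathcal{C}} \nu(C)$. 2. There exists a chain $\mathcal{U} \subseteq \mathcal{F}$ such that $\mathcal{T} \subseteq \mathcal{U}$ and $\nu(\mathcal{U}) := \{ \nu(A) : A \in \mathcal{U} \}$ is dense in $[0,1]$. 3. For every $\epsilon > 0$ there exists $N_{\epsilon} \in \mathbb{N}$ such that $| \nu_N(A) - \nu(A) | < \epsilon$ for all $A \in \mathcal{T}$ and all $N > N_{\epsilon}$. Moreover, if any of the three statements holds then, for $\mathcal{U}$ any chain as in Statement 2: 1. $\mathcal{U}_* \subseteq \mathcal{F}$ and for any $\mathcal{C} \subseteq \mathcal{U}_*$, $\nu(\bigcup \mathcal{C}) = \sup_{C \in \mathcal{C}} \nu(C)$ and $\nu(\bigcap \mathcal{C}) = \inf_{C \in \mathcal{C}} \nu(C)$; 2. $\nu(\mathcal{U}_* ) = [0,1]$; 3. for every $\epsilon > 0$ there exists $N_{\epsilon} \in \mathbb{N}$ such that $| \nu_N(A) - \nu(A) | < \epsilon$ for all $A \in \mathcal{U}_*$ and all $N > N_{\epsilon}$.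
   Context: $\mathbb{N} = \{1,2,3,\ldots\}$ and $\mathcal{P}(\mathbb{N})$ is its power set. For $A \subseteq \mathbb{N}$ and $N \in \mathbb{N}$, $\nu_N(A) := \frac{1}{N}\sum_{n=1}^N I_A(n)$, where $I_A$ is the indicator function of $A$. $\mathcal{F}$ is the collection of all $A \subseteq \mathbb{N}$ for which $\lim_{N\to\infty}\nu_N(A)$ exists, and for $A\in\mathcal{F}$, $\nu(A)$ denotes this limit. For a subcollection $\mathcal{S} \subseteq \mathcal{F}$, $\nu(\mathcal{S}) := \{\nu(A) : A\in\mathcal{S}\}$. A chain is a collection of sets totally ordered by inclusion. For a chain $\mathcal{T} \subseteq \mathcal{P}(\mathbb{N})$, $\mathcal{T}_{\cup} := \{\bigcup \mathcal{C} : \mathcal{C}\subseteq\mathcal{T}\}$, $\mathcal{T}_{\cap} := \{\bigcap \mathcal{C} : \mathcal{C}\subseteq\mathcal{T}\}$ and $\mathcal{T}_* := \mathcal{T}_{\cup}\cup\mathcal{T}_{\cap}$. Conventions for the empty subcollection: $\bigcup\emptyset=\emptyset$, $\bigcap\emptyset=\mathbb{N}$, and suprema and infima are taken in $[0,1]$, so $\sup\emptyset = 0$ and $\inf\emptyset=1$. *)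

(* Defs.v *)
(* MathComp / MathComp-Analysis *)
From mathcomp Require Export all_boot all_order all_algebra.
From mathcomp Require Export all_classical all_reals all_analysis.

Set Implicit Arguments.
Unset Strict Implicit.
Unset Printing Implicit Defensive.

Import Order.TTheory GRing.Theory Num.Theory.
Import numFieldNormedType.Exports.

Local Open Scope classical_set_scope.
Local Open Scope ring_scope.

(* The positive integers as a type of their own, so that [set posnat] is the
   full power set of {1, 2, ...} and an empty intersection is all of it. *)
Definition posnat : Type := {n : nat | (0 < n)%N}.

Definition posnatS (i : nat) : posnat := exist _ i.+1 (ltn0Sn i).

(* The sum over n = 1, ..., N is indexed by n = i + 1 with i < N.
   N = 0 is allowed and gives the irrelevant value 0. *)
Definition nuN (R : realType) (N : nat) (A : set posnat) : R :=
  N%:R^-1 * \sum_(i < N) \1_A (posnatS i).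

Definition has_density (R : realType) : set (set posnat) :=
  [set A | cvg (nuN R N A @[N --> \oo])].

(* Meaningful only for A in [has_density R]. *)
Definition nu (R : realType) (A : set posnat) : R :=
  lim (nuN R N A @[N --> \oo]).

Definition chain (S : set (set posnat)) : Prop := total_on S subset.

Definition cups (S : set (set posnat)) : set (set posnat) :=
  [set \bigcup_(X in C) X | C in [set C | C `<=` S]].

Definition caps (S : set (set posnat)) : set (set posnat) :=
  [set \bigcap_(X in C) X | C in [set C | C `<=` S]].

Definition star (S : set (set posnat)) : set (set posnat) :=
  cups S `|` caps S.

(* Suprema and infima of subsets of [0, 1], taken in [0, 1]: the two differ
   from [sup] and [inf] at most on the empty set ([inf set0] is 0). *)
Definition sup01 (R : realType) (E : set R) : R :=
  if `[< E !=set0 >] then sup E else 0.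

Definition inf01 (R : realType) (E : set R) : R :=
  if `[< E !=set0 >] then inf E else 1.

Definition nu_continuous (R : realType) (S : set (set posnat)) : Prop :=
  forall C : set (set posnat), C `<=` S ->
    nu R (\bigcup_(X in C) X) = sup01 [set nu R X | X in C] /\
    nu R (\bigcap_(X in C) X) = inf01 [set nu R X | X in C].

Definition dense_extension (R : realType) (T U : set (set posnat)) : Prop :=
  [/\ chain U, U `<=` has_density R, T `<=` U &
      `[0, 1]%classic `<=` closure [set nu R A | A in U]].

Definition nuN_uniform (R : realType) (S : set (set posnat)) : Prop :=
  forall eps : R, 0 < eps ->
    exists Neps : nat, (0 < Neps)%N /\
      forall (A : set posnat) (N : nat), S A -> (Neps < N)%N ->
        `|nuN R N A - nu R A| < eps.

(* Main.v *)
Require Import Defs.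
From mathcomp Require Import lra zify.
Import Order.TTheory GRing.Theory Num.Theory.
Import numFieldNormedType.Exports.
Local Open Scope classical_set_scope.
Local Open Scope ring_scope.

(** Read a set of positive integers as a point of the Cantor space.  Each
    [nuN N] depends on the first [N] coordinates only, hence is continuous; the
    density is the pointwise limit of these functions.  Everything follows from
    the principle that a uniform limit is as good as its approximants.

    From uniformity to continuity.  If the convergence is uniform on a
    collection [S], it is uniform on all limit points of [S] (sets that agree
    with members of [S] on arbitrarily long initial segments): see
    [limit_points_uniform].  The union or the intersection of a nonempty chain
    is a limit point of that chain, so it has a density, which is approximated
    by densities of members; by monotonicity it is their supremum or infimum
    ([uniform_continuous]).  Limit points of a chain again form a chain, which
    is why the same facts hold for [star U], all of whose members are limit
    points of [U] with the empty and the full set added ([star_uniform]).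

    From dense densities to uniformity ([dense_chain_uniform]).  This is the
    Glivenko-Cantelli (or Polya) argument: finitely many members of the chain,
    with closely spaced densities, squeeze every other member, and finitely
    many convergent sequences converge simultaneously.

    From continuity to a chain with dense densities ([fill_dense_extension]).
    For each [t] in [0, 1] the union [L] of the members of density at most [t]
    and the intersection [M] of those of density above [t] satisfy
    [L `<=` M] and [nu L <= t <= nu M] by continuity.  One inserts between them
    a set of density exactly [t], the union of [L] and a suitable proportion of
    [M `\` L].  To keep all these sets nested, an element of [M `\` L] of
    rank [k] is kept when [radical_inverse k < s], where the radical inverse is
    the van der Corput sequence, equidistributed in [0, 1]
    ([vdc_discrepancy], [density_thin]). *)

(** * Equidistribution of the van der Corput sequence *)

Section DensityChains.
Variable R : realType.
Set Implicit Arguments.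
Unset Strict Implicit.

(** The binary digits of [k] mirrored at the binary point; the fuel [f] makes
    the recursion on [k./2] structural, and any [f >= k] gives the same value. *)
Fixpoint radical_inverse_fuel (f k : nat) : R :=
  if f is f'.+1 then ((odd k)%:R + radical_inverse_fuel f' k./2) / 2 else 0.

Definition radical_inverse (k : nat) : R := radical_inverse_fuel k k.

Lemma radical_inverse_fuelE f k :
  (k <= f)%N -> radical_inverse_fuel f k = radical_inverse k.
Proof.
have stable : forall f g k, (k <= f)%N -> (k <= g)%N ->
    radical_inverse_fuel f k = radical_inverse_fuel g k.
  elim=> [|f' IH] [|g] k' //=; rewrite ?leqn0.
  - move=> /eqP-> _; elim: g => /= [|g <-]; rewrite mulr0n; lra.
  - move=> _ /eqP->; elim: f' {IH} => /= [|f' ->]; rewrite mulr0n; lra.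
  move=> kf kg; rewrite (IH g k'./2) //; lia.
by move=> kf; exact: stable.
Qed.

Lemma radical_inverseE k :
  radical_inverse k = ((odd k)%:R + radical_inverse k./2) / 2.
Proof.
case: k => [|k]; first by rewrite /radical_inverse /= mulr0n; lra.
by rewrite {1}/radical_inverse /= radical_inverse_fuelE //; lia.
Qed.

Lemma radical_inverse_even k :
  radical_inverse k.*2 = radical_inverse k / 2.
Proof. by rewrite radical_inverseE odd_double doubleK add0r. Qed.

Lemma radical_inverse_odd k :
  radical_inverse k.*2.+1 = (1 + radical_inverse k) / 2.
Proof. by rewrite radical_inverseE /= odd_double uphalf_double. Qed.

Lemma radical_inverse_bounds k : 0 <= radical_inverse k <= 1.
Proof.
suff fuel f m : 0 <= radical_inverse_fuel f m <= 1 by exact: fuel.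
elim: f m => [|f IH] m /=; first lra.
have := IH m./2; case: (odd m) => /=; lra.
Qed.

Definition vdc_count (s : R) (K : nat) : R :=
  \sum_(k < K) (radical_inverse k < s)%R%:R.

Lemma sum_parity (F : nat -> R) K :
  \sum_(k < K) F k =
  \sum_(k < uphalf K) F k.*2 + \sum_(k < K./2) F k.*2.+1.
Proof.
elim: K => [|K IH]; first by rewrite !big_ord0 addr0.
rewrite big_ord_recr IH /=.
have [oK|eK] := boolP (odd K).
  have -> : uphalf K = (K./2).+1 by lia.
  rewrite [X in _ = _ + X]big_ord_recr /= -addrA; congr (_ + (_ + F _)); lia.
have -> : uphalf K = K./2 by lia.
rewrite [X in _ = X + _]big_ord_recr /= -!addrA; congr (_ + _).
rewrite addrC; congr (F _ + _); lia.
Qed.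

(** Odd indices have radical inverse at least 1/2, so below the threshold 1/2
    only even indices count, and they reproduce the sequence at half scale. *)
Lemma vdc_count_le_half (s : R) K : s <= 1 / 2 ->
  vdc_count s K = vdc_count (2 * s) (uphalf K).
Proof.
move=> s2; rewrite /vdc_count (sum_parity (fun k => (radical_inverse k < s)%R%:R)).
rewrite [X in _ + X]big1 ?addr0 => [|k _].
  apply: eq_bigr => k _; rewrite radical_inverse_even; congr (nat_of_bool _)%:R.
  by apply/idP/idP; lra.
rewrite radical_inverse_odd; have ? := radical_inverse_bounds k.
by rewrite (_ : (_ < s) = false) //; apply/negbTE; rewrite -leNgt; lra.
Qed.

(** Above the threshold 1/2 every even index counts, and odd indices reproduce
    the sequence at half scale, shifted by 1/2. *)
Lemma vdc_count_gt_half (s : R) K : 1 / 2 < s ->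
  vdc_count s K = (uphalf K)%:R + vdc_count (2 * s - 1) K./2.
Proof.
move=> s2; rewrite /vdc_count (sum_parity (fun k => (radical_inverse k < s)%R%:R)).
congr (_ + _).
  rewrite (eq_bigr (fun=> 1)) => [|k _]; first by rewrite sumr_const card_ord.
  have ? := radical_inverse_bounds k; rewrite radical_inverse_even.
  by rewrite (_ : (_ < s) = true) //; lra.
apply: eq_bigr => k _; rewrite radical_inverse_odd; congr (nat_of_bool _)%:R.
by apply/idP/idP; lra.
Qed.

(** The discrepancy is [o(K)] uniformly in the threshold.  Keeping [j] as a free
    parameter, instead of optimizing it to [log K], allows a plain induction on
    [j]: rounding [K / 2] to an integer costs at most 1/2 in the inductive bound
    and at most 1/2 in the expected count [s * K]. *)
Lemma vdc_discrepancy (j K : nat) (s : R) : 0 <= s <= 1 ->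
  `|vdc_count s K - s * K%:R| <= K%:R / 2 ^+ j + j%:R.
Proof.
elim: j K s => [|j IH] K s s01.
  rewrite expr0 divr1 addr0.
  have w0 : 0 <= vdc_count s K by apply: sumr_ge0 => k _; exact: ler0n.
  have w1 : vdc_count s K <= K%:R.
    rewrite -[leRHS](_ : \sum_(k < K) 1 = _); last by rewrite sumr_const card_ord.
    by apply: ler_sum => k _; rewrite lern1 leq_b1.
  have K0 : 0 <= K%:R :> R by exact: ler0n.
  have := mulr_ge0 (proj1 (andP s01)) K0.
  have s1 : 0 <= 1 - s by lra.
  have := mulr_ge0 s1 K0.
  by rewrite ler_norml; lra.
have pow : 0 < (2 ^+ j : R)^-1 <= 1.
  by rewrite invr_gt0 exprn_gt0 //= invf_le1 ?exprn_gt0 // exprn_ege1 // ler1n.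
have split_pow m : m%:R / 2 ^+ j.+1 = m%:R * (2 ^+ j)^-1 / 2 :> R.
  by rewrite exprS invfM; lra.
have half : (K./2)%:R <= K%:R / 2 :> R.
  by rewrite ler_pdivlMr // -natrM ler_nat; lia.
have uphalf1 : K%:R / 2 <= (uphalf K)%:R :> R.
  by rewrite ler_pdivrMr // -natrM ler_nat; lia.
have uphalf2 : (uphalf K)%:R <= (K%:R + 1) / 2 :> R.
  by rewrite ler_pdivlMr // -natrM natr1 ler_nat; lia.
have whole : (uphalf K)%:R + (K./2)%:R = K%:R :> R.
  by rewrite -natrD; congr _%:R; lia.
rewrite split_pow -(natr1 j).
set u : R := (uphalf K)%:R in uphalf1 uphalf2 whole *.
set h : R := (K./2)%:R in half whole *.
have up : u * (2 ^+ j)^-1 <= (K%:R + 1) / 2 * (2 ^+ j)^-1.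
  by apply: ler_wpM2r => //; lra.
have hp : h * (2 ^+ j)^-1 <= K%:R / 2 * (2 ^+ j)^-1.
  by apply: ler_wpM2r => //; lra.
have [e0 e1] : 0 <= 2 * u - K%:R /\ 2 * u - K%:R <= 1 by lra.
have [s2|s2] := leP s (1 / 2).
  rewrite vdc_count_le_half //.
  have := IH (uphalf K) (2 * s) ltac:(lra); rewrite -/u.
  have : 0 <= s * (2 * u - K%:R) <= s * 1.
    by rewrite mulr_ge0 ?ler_wpM2l //; lra.
  rewrite !ler_norml; lra.
rewrite vdc_count_gt_half //.
have := IH K./2 (2 * s - 1) ltac:(lra); rewrite -/u -/h.
have hE : h = K%:R - u by lra.
have : 0 <= (1 - s) * (2 * u - K%:R) <= (1 - s) * 1.
  by rewrite mulr_ge0 ?ler_wpM2l //; lra.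
rewrite !ler_norml hE in hp *; lra.
Qed.

(** * Frequencies and densities *)

Implicit Types (A B D X Y : set posnat) (S C T U : set (set posnat)).

Local Notation density := (@nu R).
Local Notation nuN := (@nuN R).
Local Notation has_density := (@has_density R).
Local Notation nuN_uniform := (@nuN_uniform R).

Lemma posnatSK (n : posnat) : posnatS (val n).-1 = n.
Proof. by apply: val_inj => /=; rewrite prednK //; exact: (valP n). Qed.

Lemma nuN_le N A B : (forall i, (i < N)%N -> A (posnatS i) -> B (posnatS i)) ->
  nuN N A <= nuN N B.
Proof.
move=> AB; rewrite ler_wpM2l ?invr_ge0 ?ler0n //.
apply: ler_sum => i _; rewrite !indicE ler_nat.
have [/set_mem/AB ABi|//] := boolP (posnatS i \in A).
by rewrite (mem_set (ABi (ltn_ord i))).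
Qed.

Lemma nuN_subset N A B : A `<=` B -> nuN N A <= nuN N B.
Proof. by move=> AB; apply: nuN_le => i _; exact: AB. Qed.

Definition agree N A B :=
  forall i, (i < N)%N -> A (posnatS i) <-> B (posnatS i).

Lemma agree_nuN N A B : agree N A B -> nuN N A = nuN N B.
Proof.
by move=> AB; apply/eqP; rewrite eq_le !nuN_le // => i /AB [].
Qed.

Lemma nuN0 N : nuN N set0 = 0.
Proof. by rewrite /Defs.nuN big1 ?mulr0 // => i _; rewrite indic0. Qed.

Lemma nuNT N : (0 < N)%N -> nuN N setT = 1.
Proof.
move=> N0; rewrite /Defs.nuN (eq_bigr (fun=> 1)) => [|i _].
  by rewrite sumr_const card_ord mulVf // pnatr_eq0 -lt0n.
by rewrite indicT.
Qed.

Lemma nuN_bounds N A : 0 <= nuN N A <= 1.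
Proof.
rewrite -{1}(nuN0 N) nuN_subset //=.
case: N => [|N]; first by rewrite /Defs.nuN big_ord0 mulr0.
by rewrite -(@nuNT N.+1) // nuN_subset.
Qed.

Lemma nuN_setU N A B : A `&` B = set0 -> nuN N (A `|` B) = nuN N A + nuN N B.
Proof.
move=> AB; rewrite -mulrDr -big_split /=; congr (_ * _); apply: eq_bigr => i _.
rewrite !indicE in_setU; case: (boolP (_ \in A)) => Ai /=; last by rewrite add0r.
case: (boolP (_ \in B)) => Bi /=; last by rewrite addr0.
have : (A `&` B) (posnatS i) by split; exact: set_mem.
by rewrite AB.
Qed.

Lemma densityP A : has_density A -> nuN N A @[N --> \oo] --> density A.
Proof. by []. Qed.

Lemma densityE A l : nuN N A @[N --> \oo] --> l ->
  has_density A /\ density A = l.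
Proof. by move=> Al; split; [apply/cvg_ex; exists l | exact: cvg_lim]. Qed.

Lemma density_near A (e : R) : has_density A -> 0 < e ->
  \forall N \near \oo, `|nuN N A - density A| < e.
Proof. by move=> /densityP /cvgrPdistC_lt; apply. Qed.

Lemma density_le A B : has_density A -> has_density B -> A `<=` B ->
  density A <= density B.
Proof.
by move=> dA dB AB; apply: ler_lim => //; near=> N; exact: nuN_subset.
Unshelve. all: by end_near. Qed.

Lemma density_bounds A : has_density A -> 0 <= density A <= 1.
Proof.
move=> dA; apply/andP; split.
  by apply: limr_ge => //; near=> N; have /andP[] := nuN_bounds N A.
by apply: limr_le => //; near=> N; have /andP[] := nuN_bounds N A.
Unshelve. all: by end_near. Qed.

Lemma has_density0 : has_density set0 /\ density set0 = 0.
Proof.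
apply: densityE; rewrite (_ : (fun N => _) = fun=> 0); first exact: cvg_cst.
by apply/funext => N; exact: nuN0.
Qed.

Lemma has_densityT : has_density setT /\ density setT = 1.
Proof.
apply: densityE; apply/cvgrPdistC_lt => e e0; near=> N.
rewrite nuNT ?subrr ?normr0 //; near: N; exact: nbhs_infty_gt.
Unshelve. all: by end_near. Qed.

Lemma density_setU A B : has_density A -> has_density B -> A `&` B = set0 ->
  has_density (A `|` B) /\ density (A `|` B) = density A + density B.
Proof.
move=> dA dB AB; apply: densityE.
rewrite (_ : (fun N => _) = fun N => nuN N A + nuN N B); first exact: cvgD.
by apply/funext => N; exact: nuN_setU.
Qed.

Lemma density_setD A B : has_density A -> has_density B -> A `<=` B ->
  has_density (B `\` A) /\ density (B `\` A) = density B - density A.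
Proof.
move=> dA dB AB; apply: densityE.
rewrite (_ : (fun N => _) = fun N => nuN N B - nuN N A); first exact: cvgB.
apply/funext => N; rewrite -{2}(setDUK AB) nuN_setU; last by rewrite setDIK.
by rewrite addrC addKr.
Qed.

(** * Subsets of prescribed relative density *)

Definition rank D (n : nat) : nat := \sum_(i < n) (posnatS i \in D).

(** Selecting by rank inside [D], not by value, is what makes the relative
    density of [thin D s] equal to [s] whatever [D] is; a single threshold
    sequence for all [s] is what makes the selection increasing in [s]. *)
Definition thin D (s : R) : set posnat :=
  [set n | D n /\ radical_inverse (rank D (val n).-1) < s].

Lemma thin_subset D s : thin D s `<=` D.
Proof. by move=> n []. Qed.

Lemma thin_mono D s t : s <= t -> thin D s `<=` thin D t.
Proof. by move=> st n [Dn ns]; split => //; exact: lt_le_trans st. Qed.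

Lemma nuN_thin N D s : nuN N (thin D s) = N%:R^-1 * vdc_count s (rank D N).
Proof.
congr (_ * _); elim: N => [|N IH].
  by rewrite /rank /vdc_count !big_ord0.
rewrite big_ord_recr IH /= {2}/rank big_ord_recr /= -/(rank D N) indicE.
have [DN|DN] := boolP (posnatS N \in D); last first.
  by rewrite addn0 memNset ?addr0 // => -[/mem_set]; rewrite (negbTE DN) //.
rewrite addn1 /vdc_count [RHS]big_ord_recr /=; congr (_ + (nat_of_bool _)%:R).
by apply/idP/idP => [/set_mem[]|?] //; apply/mem_set; split=> //; exact: set_mem.
Qed.

Lemma rankE N D : (rank D N)%:R = \sum_(i < N) \1_D (posnatS i) :> R.
Proof. by rewrite /rank natr_sum; apply: eq_bigr => i _; rewrite indicE. Qed.

(** The discrepancy bound gives a difference of at most [2^-j + j / N] between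
    the frequencies, which is small for a fixed large [j] and then large [N];
    this also covers the case where [D] is finite or has density 0. *)
Lemma density_thin D s : has_density D -> 0 <= s <= 1 ->
  has_density (thin D s) /\ density (thin D s) = s * density D.
Proof.
move=> dD s01; apply: densityE.
suff diff : nuN N (thin D s) - s * nuN N D @[N --> \oo] --> (0 : R).
  rewrite -[X in _ --> X]add0r.
  rewrite (_ : (fun N => nuN N _) =
    fun N => (nuN N (thin D s) - s * nuN N D) + s * nuN N D).
    by apply: cvgD => //; apply: cvgM => //; exact: cvg_cst.
  by apply/funext => N; rewrite subrK.
apply/cvgrPdistC_lt => e e0.
pose j := Num.bound (2 / e).
have je : (2 ^+ j)^-1 < e / 2.
  rewrite -[ltRHS]invf_div ltf_pV2 ?posrE ?exprn_gt0 // ?divr_gt0 //.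
  exact: upper_nthrootP.
near=> N.
have N0 : (0 < N)%N by near: N; exact: nbhs_infty_gt.
have NR : 0 < N%:R :> R by rewrite ltr0n.
have jN : j%:R / N%:R < e / 2.
  rewrite ltr_pdivrMr // mulrC -ltr_pdivrMr ?divr_gt0 //.
  by near: N; exact: nbhs_infty_gtr.
rewrite subr0 nuN_thin /Defs.nuN -rankE mulrCA -mulrBr normrM.
rewrite ger0_norm ?invr_ge0 ?ler0n // mulrC.
rewrite ltr_pdivrMr //.
apply: le_lt_trans (vdc_discrepancy j (rank D N) s01) _.
have rN : (rank D N)%:R <= N%:R :> R.
  rewrite ler_nat /rank -[leqRHS]card_ord -sum1_card.
  by apply: leq_sum => i _; exact: leq_b1.
rewrite ltr_pdivrMr // in jN.
have := ler_wpM2r (ltW _ : 0 <= (2 ^+ j)^-1 :> R) rN.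
have := ltr_pM2l NR ((2 ^+ j)^-1) (e / 2).
rewrite je invr_gt0 exprn_gt0 // => H /(_ isT) H2.
by lra.
Unshelve. all: by end_near. Qed.

(** * Uniform convergence passes to limit points *)

Definition limit_points S : set (set posnat) :=
  [set X | forall M, exists2 A, S A & agree M A X].

Lemma sub_limit_points S : S `<=` limit_points S.
Proof. by move=> A SA M; exists A. Qed.

Lemma limit_pointsS S T : S `<=` T -> limit_points S `<=` limit_points T.
Proof. by move=> ST X SX M; have [A /ST TA AX] := SX M; exists A. Qed.

(** For each bound on the indices the frequencies of a limit point coincide with
    those of a member of [S]; so they form a Cauchy sequence, with the uniform
    rate. *)
Lemma limit_points_has_density S : nuN_uniform S ->
  limit_points S `<=` has_density.
Proof.
move=> unif X SX; apply: cauchy_cvg; apply: cauchy_exP => e e0.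
have [M [_ HM]] := unif (e / 2) ltac:(lra).
exists (nuN M.+1 X); exists M.+1 => // N /= MN.
have [A SA AX] := SX N.
have AXM : agree M.+1 A X by move=> i iM; apply: AX; exact: leq_trans MN.
have := HM A M.+1 SA (leqnn _); have := HM A N SA MN.
rewrite (agree_nuN AX) (agree_nuN AXM) /ball /= !ltr_norml; lra.
Qed.

(** To compare [nuN N X] with the density of [X], replace [X] by a member of [S]
    that agrees with it both up to [N] and up to an index, depending on [X],
    where the frequency of [X] is already close to its density. *)
Lemma limit_points_uniform S : nuN_uniform S -> nuN_uniform (limit_points S).
Proof.
move=> unif e e0; have [M [M0 HM]] := unif (e / 3) ltac:(lra).
exists M; split=> // X N SX MN.
have dX := limit_points_has_density unif SX.
have [K _ HK] := density_near dX (ltac:(lra) : 0 < e / 3).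
have := HK (maxn N K) (leq_maxr _ _); have [A SA AX] := SX (maxn N K).
have AXN : agree N A X.
  by move=> i iN; apply: AX; exact: leq_trans (leq_maxl _ _).
have := HM A N SA MN.
have := HM A (maxn N K) SA (leq_trans MN (leq_maxl _ _)).
rewrite /= (agree_nuN AX) (agree_nuN AXN) !ltr_norml; lra.
Qed.

(** Continuity of the density on limit points: evaluate both densities at one
    index of the uniform rate, up to which the two sets agree. *)
Lemma limit_points_near S X (e : R) : nuN_uniform S -> limit_points S X ->
  0 < e -> exists2 A, S A & `|density A - density X| < e.
Proof.
move=> unif SX e0.
have [M [_ HM]] := limit_points_uniform unif (ltac:(lra) : 0 < e / 2).
have [A SA AX] := SX M.+1; exists A => //.
have := HM A M.+1 (sub_limit_points SA) (leqnn _).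
have := HM X M.+1 SX (leqnn _).
rewrite (agree_nuN AX) !ltr_norml; lra.
Qed.

(** That two sets are incomparable is witnessed by two integers, hence is already
    seen on members of [S] that agree with them far enough. *)
Lemma limit_points_chain S : chain S -> chain (limit_points S).
Proof.
move=> chS X Y SX SY; apply: contrapT => /not_orP[].
move=> /nonsubset[i [Xi nYi]] /nonsubset[j [Yj nXj]].
pose M := maxn (val i) (val j).
have [A SA AX] := SX M; have [B SB BY] := SY M.
have iM : ((val i).-1 < M)%N by have := valP i; rewrite /M; lia.
have jM : ((val j).-1 < M)%N by have := valP j; rewrite /M; lia.
have := AX _ iM; have := BY _ iM; have := AX _ jM; have := BY _ jM.
rewrite !posnatSK => Bj Aj Bi Ai.
have [AB|BA] := chS A B SA SB.
  by apply/nYi/Bi/AB/Ai.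
by apply/nXj/Aj/BA/Bj.
Qed.

(** Finitely many elements of the union of a chain lie in a single member. *)
Lemma bigcup_limit_point C : chain C -> C !=set0 ->
  limit_points C (\bigcup_(X in C) X).
Proof.
move=> chC [A0 CA0] M.
suff [A CA AM] : exists2 A, C A & forall i, (i < M)%N ->
    (\bigcup_(X in C) X) (posnatS i) -> A (posnatS i).
  by exists A => // i iM; split=> [Ai|/AM-/(_ iM)//]; exists A.
elim: M => [|M [A CA AM]]; first by exists A0.
have [[B CB BM]|noB] := pselect ((\bigcup_(X in C) X) (posnatS M)); last first.
  by exists A => // i; rewrite ltnS leq_eqVlt => /predU1P[-> /noB//|/AM].
have [AB|BA] := chC A B CA CB; [exists B|exists A] => //.
  by move=> i; rewrite ltnS leq_eqVlt => /predU1P[->//|iM /(AM _ iM)/AB].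
by move=> i; rewrite ltnS leq_eqVlt => /predU1P[-> _|/AM//]; exact: BA.
Qed.

Lemma bigcap_limit_point C : chain C -> C !=set0 ->
  limit_points C (\bigcap_(X in C) X).
Proof.
move=> chC [A0 CA0] M.
suff [A CA AM] : exists2 A, C A & forall i, (i < M)%N ->
    A (posnatS i) -> (\bigcap_(X in C) X) (posnatS i).
  by exists A => // i iM; split=> [/AM-/(_ iM)//|]; exact.
elim: M => [|M [A CA AM]]; first by exists A0.
have [allM|/existsNP[B /not_implyP[CB nBM]]] :=
    pselect ((\bigcap_(X in C) X) (posnatS M)).
  by exists A => // i; rewrite ltnS leq_eqVlt => /predU1P[->|/AM].
have [AB|BA] := chC A B CA CB; [exists A|exists B] => //.
  by move=> i; rewrite ltnS leq_eqVlt => /predU1P[-> /AB//|/AM].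
by move=> i; rewrite ltnS leq_eqVlt => /predU1P[->//|iM /BA/(AM _ iM)].
Qed.

(** * Continuity along chains *)

Lemma sup01_eq (E : set R) (x : R) : E !=set0 -> (forall y, E y -> y <= x) ->
  (forall e, 0 < e -> exists2 y, E y & x - e < y) -> sup01 E = x.
Proof.
move=> E0 Ex adh; rewrite /sup01 asboolT //; apply/eqP; rewrite eq_le.
rewrite ge_sup //=; apply/ler_addgt0Pl => e /adh[y Ey].
have : y <= sup E by apply: ub_le_sup => //; exists x.
lra.
Qed.

Lemma inf01_eq (E : set R) (x : R) : E !=set0 -> (forall y, E y -> x <= y) ->
  (forall e, 0 < e -> exists2 y, E y & y < x + e) -> inf01 E = x.
Proof.
move=> E0 Ex adh; rewrite /inf01 asboolT //; apply/eqP; rewrite eq_le.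
rewrite lb_le_inf // andbT; apply/ler_addgt0Pr => e /adh[y Ey].
have : inf E <= y by apply: ge_inf => //; exists x.
lra.
Qed.

Lemma sup01_0 : sup01 set0 = 0 :> R.
Proof. by rewrite /sup01 asboolF // => -[]. Qed.

Lemma inf01_0 : inf01 set0 = 1 :> R.
Proof. by rewrite /inf01 asboolF // => -[]. Qed.

Lemma sup01_le (E : set R) (x : R) : 0 <= x -> (forall y, E y -> y <= x) ->
  sup01 E <= x.
Proof. by rewrite /sup01; case: asboolP => // E0 _; exact: ge_sup. Qed.

Lemma inf01_ge (E : set R) (x : R) : x <= 1 -> (forall y, E y -> x <= y) ->
  x <= inf01 E.
Proof. by rewrite /inf01; case: asboolP => // E0 _; exact: lb_le_inf. Qed.

Lemma uniform_sub S T : S `<=` T -> nuN_uniform T -> nuN_uniform S.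
Proof.
move=> ST unif e /unif[M [M0 HM]]; exists M; split=> // A N /ST; exact: HM.
Qed.

(** Monotonicity of the density gives one inequality, and its continuity at the
    limit points [\bigcup C] and [\bigcap C] of [C] gives the other. *)
Lemma uniform_continuous S : S `<=` has_density -> chain S -> nuN_uniform S ->
  star S `<=` has_density /\ nu_continuous R S.
Proof.
move=> dS chS unif.
have lim C : C `<=` S -> C !=set0 ->
    [/\ nuN_uniform C, limit_points C (\bigcup_(X in C) X),
      limit_points C (\bigcap_(X in C) X) & limit_points C `<=` has_density].
  move=> CS C0.
  have chC : chain C by move=> A B /CS SA /CS; exact: chS.
  have unifC := uniform_sub CS unif.
  split=> //; [exact: bigcup_limit_point|exact: bigcap_limit_point|].
  exact: limit_points_has_density.
split.
  move=> _ [] [C /= CS <-]; have [->|/set0P C0] := eqVneq C set0.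
  - by rewrite bigcup_set0; have [] := has_density0.
  - by have [_ Cu _] := lim C CS C0; apply.
  - by rewrite bigcap_set0; have [] := has_densityT.
  - by have [_ _ Ci] := lim C CS C0; apply.
move=> C CS; have [->|/set0P C0] := eqVneq C set0.
  rewrite bigcup_set0 bigcap_set0 image_set0 sup01_0 inf01_0.
  by have [_ ->] := has_density0; have [_ ->] := has_densityT.
have [unifC Cu Ci dlim] := lim C CS C0.
have E0 : [set density X | X in C] !=set0 by exact: image_nonempty.
split; apply/esym.
  apply: sup01_eq => // [_ [A CA <-]|e e0].
    by apply: density_le; [exact/dS/CS|exact: dlim|exact: bigcup_sup].
  have [A CA near_A] := limit_points_near unifC Cu e0.
  exists (density A); first by exists A.
  by move: near_A; rewrite ltr_norml; lra.
apply: inf01_eq => // [_ [A CA <-]|e e0].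
  by apply: density_le; [exact: dlim|exact/dS/CS|exact: bigcap_inf].
have [A CA near_A] := limit_points_near unifC Ci e0.
exists (density A); first by exists A.
by move: near_A; rewrite ltr_norml; lra.
Qed.

(** The empty union and the empty intersection need not be limit points of the
    chain; the two extreme sets account for them. *)
Definition with_extremes S := S `|` [set set0; setT].

Lemma with_extremes_chain S : chain S -> chain (with_extremes S).
Proof.
by move=> chS A B [SA|[]->] [SB|[]->]; [exact: chS|..];
  do ?[by left; exact: sub0set | by right; exact: sub0set
      | by left; exact: subsetT | by right; exact: subsetT].
Qed.

Lemma with_extremes_uniform S : nuN_uniform S -> nuN_uniform (with_extremes S).
Proof.
move=> unif e e0; have [M [M0 HM]] := unif e e0; exists M; split=> //.
move=> A N [|[]->] MN; first by move=> SA; exact: HM.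
  by rewrite nuN0; have [_ ->] := has_density0; rewrite subrr normr0.
rewrite nuNT; last exact: leq_ltn_trans MN.
by have [_ ->] := has_densityT; rewrite subrr normr0.
Qed.

Lemma star_limit_points S : chain S ->
  star S `<=` limit_points (with_extremes S).
Proof.
move=> chS.
have chC C : C `<=` S -> chain C by move=> CS A B /CS SA /CS; exact: chS.
have CS' C : C `<=` S -> limit_points C `<=` limit_points (with_extremes S).
  by move=> CS; apply: limit_pointsS => A /CS; left.
move=> _ [] [C /= CS <-]; have [->|/set0P C0] := eqVneq C set0.
- by rewrite bigcup_set0; apply: sub_limit_points; right; left.
- by apply: CS' (bigcup_limit_point _ _) => //; exact: chC.
- by rewrite bigcap_set0; apply: sub_limit_points; right; right.
- by apply: CS' (bigcap_limit_point _ _) => //; exact: chC.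
Qed.

Lemma star_uniform S : chain S -> nuN_uniform S ->
  [/\ chain (star S), star S `<=` has_density & nuN_uniform (star S)].
Proof.
move=> chS unif; have SL := star_limit_points chS.
have unifB := with_extremes_uniform unif; split.
- move=> A B /SL LA /SL LB.
  exact: limit_points_chain (with_extremes_chain chS) _ _ LA LB.
- by move=> A /SL; exact: limit_points_has_density.
- exact: uniform_sub SL (limit_points_uniform unifB).
Qed.

(** * Chains with dense densities *)

Definition dense_densities U : Prop :=
  `[0, 1]%classic `<=` closure [set density A | A in U].

Lemma dense_between U (a b : R) : dense_densities U -> 0 <= a -> a < b ->
  b <= 1 -> exists2 A, U A & a < density A < b.
Proof.
move=> dense a0 ab b1.
have /dense/(_ `]a, b[%classic) : `[0, 1]%classic ((a + b) / 2).
  by rewrite /= in_itv /=; lra.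
case; first by apply: open_nbhs_nbhs; split => //=; rewrite in_itv /=; lra.
by move=> _ [[A UA <-]]; rewrite /= in_itv /= => abA; exists A.
Qed.

(** A member whose density lies in [[k h, (k + 1) h[] is squeezed between two
    sets chosen for [k] alone, of densities at least [(k - 1) h] and at most
    [(k + 2) h].  The induction on [k] sweeps [0, 1] by steps of [h]. *)
Lemma dense_chain_uniform U : U `<=` has_density -> chain U ->
  dense_densities U -> nuN_uniform U.
Proof.
move=> dU chU dense e e0; pose h := e / 3; have h0 : 0 < h by rewrite /h; lra.
have below (a b : R) : a < b -> b <= 1 -> exists L, [/\ has_density L,
    a <= density L & forall A, U A -> b <= density A -> L `<=` A].
  move=> ab b1; have [a0|a0] := ltP a 0.
    by exists set0; have [? ->] := has_density0; split=> [||A _ _]; [|exact: ltW|exact: sub0set].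
  have [L UL /andP[aL Lb]] := dense_between dense a0 ab b1.
  exists L; split; [exact: dU|exact: ltW|move=> A UA bA].
  have [//|AL] := chU L A UL UA.
  have := density_le (dU _ UA) (dU _ UL) AL; lra.
have above (a b : R) : 0 <= a -> a < b -> exists W, [/\ has_density W,
    density W <= b & forall A, U A -> density A <= a -> A `<=` W].
  move=> a0 ab; have [b1|b1] := ltP 1 b.
    by exists setT; have [? ->] := has_densityT; split=> [||A _ _]; [|exact: ltW|exact: subsetT].
  have [W UW /andP[aW Wb]] := dense_between dense a0 ab b1.
  exists W; split; [exact: dU|exact: ltW|move=> A UA Aa].
  have [//|WA] := chU A W UA UW.
  have := density_le (dU _ UW) (dU _ UA) WA; lra.
(* The strict bound makes the case k = 0 vacuous. *)
have step k : \forall N \near \oo, forall A, U A -> density A < k%:R * h ->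
    `|nuN N A - density A| < e.
  elim: k => [|k IH].
    near=> N => A UA; rewrite mul0r.
    have := density_bounds (dU _ UA); lra.
  have kh0 : 0 <= k%:R * h by rewrite mulr_ge0 // ltW.
  have [kh1|kh1] := ltP 1 (k%:R * h).
    near=> N => A UA _; have dA := density_bounds (dU _ UA).
    have : density A < k%:R * h by lra.
    by move: A UA {dA}; near: N; apply: filterS IH => N H A ?; exact: H.
  have [L [dL hL LA]] := below (k%:R * h - h) (k%:R * h) ltac:(lra) kh1.
  have [W [dW hW AW]] :=
    above (k%:R * h + h) (k%:R * h + h + h) ltac:(lra) ltac:(lra).
  near=> N => A UA; rewrite -natr1 mulrDl mul1r => Ak.
  have [Ak'|kA] := ltP (density A) (k%:R * h).
    move: A UA Ak' {Ak}; near: N; exact: IH.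
  have := nuN_subset N (LA A UA kA).
  have := nuN_subset N (AW A UA (ltW Ak)).
  have : `|nuN N L - density L| < h by near: N; exact: density_near.
  have : `|nuN N W - density W| < h by near: N; exact: density_near.
  rewrite !ltr_norml /h in hL hW Ak kA *; lra.
pose k := Num.bound h^-1.
have [M _ HM] := step k; exists M.+1; split=> // A N UA MN.
apply: HM => //=; first exact/ltnW/ltnW.
have kh : 1 < k%:R * h.
  by rewrite -ltr_pdivrMr // mul1r archi_boundP // invr_ge0 ltW.
have := density_bounds (dU _ UA); lra.
Unshelve. all: by end_near. Qed.

(** The union of the members of density at most [t] has density exactly [t],
    because the density is continuous and its values accumulate at [t] from
    below.  For [t = 0] there may be no such member; the empty set serves. *)
Lemma dense_chain_star_density U : U `<=` has_density -> chain U ->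
  dense_densities U -> [set density A | A in star U] = `[0, 1]%classic.
Proof.
move=> dU chU dense; have unif := dense_chain_uniform dU chU dense.
have [dstar cont] := uniform_continuous dU chU unif.
apply/seteqP; split=> [_ [A /dstar dA <-]|t].
  by rewrite /= in_itv /=; exact: density_bounds.
rewrite /= in_itv /= => /andP[t0 t1]; move: t0.
rewrite le_eqVlt => /predU1P[<-|t0].
  exists set0; last by have [] := has_density0.
  by left; exists set0; [exact: sub0set|rewrite bigcup_set0].
pose C := [set A | U A /\ density A <= t]; have CU : C `<=` U by move=> A [].
have near_t (e : R) : 0 < e -> exists2 A, C A & t - e < density A.
  move=> e0; have [|||A UA] := @dense_between U (Num.max 0 (t - e)) t dense.
  - by rewrite le_max lexx.
  - by rewrite gt_max t0 /=; lra.
  - by [].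
  by rewrite gt_max => /andP[/andP[_ eA] At]; exists A => //; split=> //; exact: ltW.
exists (\bigcup_(X in C) X); first by left; exists C.
have [-> _] := cont C CU; apply: sup01_eq.
- by have [A CA _] := near_t 1 ltr01; exists (density A); exists A.
- by move=> _ [A [_ At] <-].
- by move=> e /near_t[A CA eA]; exists (density A) => //; exists A.
Qed.

(** * Filling the gaps of a continuous chain *)

Section Filling.
Variable T : set (set posnat).
Hypothesis dT : T `<=` has_density.
Hypothesis chT : chain T.
Hypothesis dstar : star T `<=` has_density.
Hypothesis cont : nu_continuous R T.

Let low (t : R) := [set A | T A /\ density A <= t].
Let high (t : R) := [set A | T A /\ t < density A].
Let lower t := \bigcup_(X in low t) X.
Let upper t := \bigcap_(X in high t) X.

(** The proportion kept solves
    [nu (lower t) + s * (nu (upper t) - nu (lower t)) = t].  If the two densities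
    coincide then both equal [t], and the convention [x / 0 = 0] does no
    harm. *)
Definition fill (t : R) : set posnat :=
  lower t `|` thin (upper t `\` lower t)
    ((t - density (lower t)) / (density (upper t) - density (lower t))).

Let low_sub t : low t `<=` T. Proof. by move=> A []. Qed.
Let high_sub t : high t `<=` T. Proof. by move=> A []. Qed.

Let d_lower t : has_density (lower t).
Proof. by apply: dstar; left; exists (low t) => //; exact: low_sub. Qed.

Let d_upper t : has_density (upper t).
Proof. by apply: dstar; right; exists (high t) => //; exact: high_sub. Qed.

Let lower_le t : 0 <= t -> density (lower t) <= t.
Proof.
move=> t0; have [-> _] := cont (@low_sub t).
by apply: sup01_le => // _ [A [_ At] <-].
Qed.

Let upper_ge t : t <= 1 -> t <= density (upper t).
Proof.
move=> t1; have [_ ->] := cont (@high_sub t).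
by apply: inf01_ge => // _ [A [_ At] <-]; exact: ltW.
Qed.

Let lower_upper t : lower t `<=` upper t.
Proof.
move=> n [A [TA At] An] B [TB tB].
have [AB|BA] := chT TA TB; first exact: AB.
have := density_le (dT TB) (dT TA) BA; lra.
Qed.

Let fill_upper t : fill t `<=` upper t.
Proof. by move=> n [/lower_upper//|/thin_subset[]]. Qed.

Lemma sub_fill A t : T A -> density A <= t -> A `<=` fill t.
Proof. by move=> TA At n An; left; exists A. Qed.

Lemma fill_sub A t : T A -> t < density A -> fill t `<=` A.
Proof. by move=> TA tA n /fill_upper; apply. Qed.

Lemma density_fill t : 0 <= t <= 1 ->
  has_density (fill t) /\ density (fill t) = t.
Proof.
case/andP => t0 t1; have lt_t := lower_le t0; have t_ut := upper_ge t1.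
have [dD De] := density_setD (@d_lower t) (@d_upper t) (@lower_upper t).
set s := (t - density (lower t)) / (density (upper t) - density (lower t)).
have s01 : 0 <= s <= 1.
  have [e|ne] := eqVneq (density (upper t) - density (lower t)) 0.
    by rewrite /s e invr0 mulr0 lexx ler01.
  have p : 0 < density (upper t) - density (lower t) by rewrite lt_def ne; lra.
  by rewrite /s divr_ge0 ?ler_pdivrMr ?mul1r //; lra.
have [dth the] := density_thin dD s01.
have disj : lower t `&` thin (upper t `\` lower t) s = set0.
  by apply/seteqP; split=> // n [? /thin_subset[]].
have [dG Ge] := density_setU (@d_lower t) dth disj.
split=> //; rewrite /fill -/s Ge the De /s.
have [e|ne] := eqVneq (density (upper t) - density (lower t)) 0.
  by rewrite e mulr0; lra.
by rewrite divfK // addrC subrK.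
Qed.

(** Either a member of [T] separates [fill s] from [fill t], or [s] and [t] define
    the same cut of [T]; then only the proportion changes, and it increases. *)
Lemma fill_mono s t : 0 <= s -> s <= t -> t <= 1 -> fill s `<=` fill t.
Proof.
move=> s0 st t1.
have [[A [TA sA At]]|noA] :=
    pselect (exists A, [/\ T A, s < density A & density A <= t]).
  exact: subset_trans (fill_sub TA sA) (sub_fill TA At).
have lowE : low s = low t.
  apply/seteqP; split=> A [TA dA]; split=> //; first lra.
  by rewrite leNgt; apply/negP => sA; apply: noA; exists A.
have highE : high s = high t.
  apply/seteqP; split=> A [TA dA]; split=> //; last lra.
  by rewrite ltNge; apply/negP => At; apply: noA; exists A.
have lE : lower s = lower t by rewrite /lower lowE.
have uE : upper s = upper t by rewrite /upper highE.
rewrite /fill lE uE; apply: setUS; apply: thin_mono.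
have := lower_le (le_trans s0 st); have := upper_ge t1.
by move=> t_ut lt_t; rewrite ler_wpM2r ?invr_ge0; lra.
Qed.

Lemma fill_dense_extension : exists U, dense_extension R T U.
Proof.
exists (T `|` [set fill t | t in `[0, 1]%classic]); split.
- have TG A t : T A -> A `<=` fill t \/ fill t `<=` A.
    move=> TA; have [At|tA] := leP (density A) t; [left|right].
      exact: sub_fill.
    exact: fill_sub.
  move=> A B [TA|[s + <-]] [TB|[t + <-]]; first exact: chT.
  + by move=> _; exact: TG.
  + by move=> _; have [] := TG _ s TB; [right|left].
  rewrite /= !in_itv /= => /andP[t0 t1] /andP[s0 s1].
  by have [st|/ltW ts] := leP s t; [left|right]; exact: fill_mono.
- move=> A [/dT//|[t + <-]]; rewrite /= in_itv /= => t01.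
  by have [] := density_fill t01.
- by move=> A TA; left.
- move=> t t01; apply: subset_closure; exists (fill t); first by right; exists t.
  by move: t01; rewrite /= in_itv /= => /density_fill[].
Qed.

End Filling.
End DensityChains.

Theorem theorem4 (R : realType) (T : set (set posnat))
    (T_density : T `<=` has_density R) (T_chain : chain T) :
  [<-> star T `<=` has_density R /\ nu_continuous R T;
       exists U : set (set posnat), dense_extension R T U;
       nuN_uniform R T]
  /\
  ([\/ star T `<=` has_density R /\ nu_continuous R T,
       exists U : set (set posnat), dense_extension R T U |
       nuN_uniform R T] ->
   forall U : set (set posnat), dense_extension R T U ->
     [/\ star U `<=` has_density R /\ nu_continuous R (star U),
         [set nu R A | A in star U] = `[0, 1]%classic &
         nuN_uniform R (star U)]).
Proof.
split.
  tfae.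
  - by move=> [dstar cont]; exact: fill_dense_extension.
  - move=> [U [chU dU TU dense]].
    exact: uniform_sub TU (dense_chain_uniform dU chU dense).
  - exact: uniform_continuous.
move=> _ U [chU dU TU dense].
have unif := dense_chain_uniform dU chU dense.
have [chS dS unifS] := star_uniform chU unif.
split=> //; last exact: dense_chain_star_density.
by split=> //; have [] := uniform_continuous dS chS unifS.
Qed.
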